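(* Let $n\ge2$, let $K\subset\mathbb{R}^n$ be a convex body, let $C\subset\mathbb{R}^n$ be a Minkowski-centered convex body with $0$ in its interior, and let $s\in\mathbb{R}^n\setminus\{0\}$. Then: (i) $$l_{s,\mathrm{MIN}}(K,C)=\max_{x,y\in K,\ x-y\in\mathrm{pos}(s)}\max\left(\|x-y\|_C,\|x-y\|_{-C}\right)=l_{s,\mathrm{MIN}}(K,C\cap(-C))=l_{s,\mathrm{AM}}(K,C\cap(-C))$$ $$=l_{s,\mathrm{MIN}}\left(\tfrac{K-K}{2},C\cap(-C)\right)=l_{s,\mathrm{MIN}}\left(\tfrac{K-K}{2},C\right);$$ (ii) $$D_{\mathrm{MIN}}(K,C)=D_{\mathrm{MIN}}(K,C\cap(-C))=D_{\mathrm{MIN}}\left(\tfrac{K-K}{2},C\cap(-C)\right)=D_{\mathrm{MIN}}\left(\tfrac{K-K}{2},C\right)=D_{\mathrm{AM}}(K,C\cap(-C)).$$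
   Context: A convex body is a nonempty compact convex set. $\|x\|_C=\min\{\lambda\ge0:x\in\lambda C\}$ is the gauge function; $\mathrm{pos}(s)=\{\lambda s:\lambda\ge0\}$, $\mathrm{lin}(s)=\{\lambda s:\lambda\in\mathbb{R}\}$; $[x,y]$ is the segment with endpoints $x,y$. The circumradius is $R(K,C)=\inf\{\rho\ge0:\exists t,\ K\subset t+\rho C\}$. $C$ is Minkowski-centered if $C\subset -R(C,-C)\,C$. For a convex body $K$, a gauge $C$ (convex body with $0$ in its interior) and $s\ne0$: $$l_{s,\mathrm{MIN}}(K,C)=\max_{x,y\in K,\ x-y\in\mathrm{lin}(s)}\|x-y\|_C,\qquad l_{s,\mathrm{AM}}(K,C)=\max_{x,y\in K,\ x-y\in\mathrm{lin}(s)}2R([x,y],C),$$ $$D_{\mathrm{MIN}}(K,C)=\max_{s\ne0}l_{s,\mathrm{MIN}}(K,C),\qquad D_{\mathrm{AM}}(K,C)=\max_{s\ne0}l_{s,\mathrm{AM}}(K,C).$$ *)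

(* Defs.v *)
From HB Require Import structures.
From mathcomp Require Import all_boot all_order all_algebra.
From mathcomp Require Import all_classical all_reals all_analysis.

Set Implicit Arguments.
Unset Strict Implicit.
Unset Printing Implicit Defensive.

Import Order.TTheory GRing.Theory Num.Theory.
Import numFieldNormedType.Exports.

Local Open Scope classical_set_scope.
Local Open Scope ring_scope.

Section extrema.
Context {R : realType}.
Implicit Types A : set R.

(* A `&` ubound A has at most one element, namely the maximum of A.  The value
   0 of max_of (resp. min_of) is only taken on sets with no maximum (resp. no
   minimum). *)
Definition has_max A : Prop := A `&` ubound A !=set0.
Definition max_of A : R := xget 0 (A `&` ubound A).
Definition min_of A : R := xget 0 (A `&` lbound A).

End extrema.

Section convex_bodies.
Context {R : realType} {n : nat}.
Local Notation V := 'rV[R]_n.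
Implicit Types (K C : set V) (s x y : V).

Definition convex_body K : Prop :=
  [/\ K !=set0, compact K & convex_set (K : set (convex_lmodType V))].

Definition dilate (a : R) K : set V := [set a *: x | x in K].

Definition translate (t : V) K : set V := [set t + x | x in K].

Definition opp_set K : set V := [set - x | x in K].

Definition half_difference K : set V := [set 2^-1 *: (x - y) | x in K & y in K].

Definition segment x y : set V :=
  [set (1 - t) *: x + t *: y | t in [set t : R | 0 <= t <= 1]].

Definition pos s : set V := [set l *: s | l in [set l : R | 0 <= l]].

Definition lin s : set V := [set l *: s | l in [set: R]].

Definition gauge_fun C x : R := min_of [set l : R | 0 <= l /\ dilate l C x].

Definition circumradius K C : R :=
  inf [set rho : R | 0 <= rho /\ exists t : V, K `<=` translate t (dilate rho C)].

Definition Minkowski_centered C : Prop :=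
  C `<=` dilate (- circumradius C (opp_set C)) C.

Definition chords K (L : set V) : set (V * V) :=
  [set p | [/\ K p.1, K p.2 & L (p.1 - p.2)]].

Definition lengths_MIN s K C : set R :=
  [set gauge_fun C (p.1 - p.2) | p in chords K (lin s)].

Definition lengths_AM s K C : set R :=
  [set 2 * circumradius (segment p.1 p.2) C | p in chords K (lin s)].

Definition lengths_pos s K C : set R :=
  [set Num.max (gauge_fun C (p.1 - p.2)) (gauge_fun (opp_set C) (p.1 - p.2))
     | p in chords K (pos s)].

Definition l_MIN s K C : R := max_of (lengths_MIN s K C).
Definition l_AM s K C : R := max_of (lengths_AM s K C).

Definition maxlengths_MIN K C : set R := [set l_MIN s K C | s in [set s : V | s != 0]].
Definition maxlengths_AM K C : set R := [set l_AM s K C | s in [set s : V | s != 0]].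

Definition D_MIN K C : R := max_of (maxlengths_MIN K C).
Definition D_AM K C : R := max_of (maxlengths_AM K C).

End convex_bodies.

(* Main.v *)
Require Import Defs.
From HB Require Import structures.
From mathcomp Require Import all_boot all_order all_algebra.
From mathcomp Require Import all_classical all_reals all_analysis.
From mathcomp Require Import ring lra.
Import Order.TTheory GRing.Theory Num.Theory.
Import numFieldNormedType.Exports.
Local Open Scope classical_set_scope.
Local Open Scope ring_scope.

Set Implicit Arguments.
Unset Strict Implicit.
Unset Printing Implicit Defensive.

(** Every length in the theorem depends on [K] only through the set
[differences K] of the vectors [x - y] with [x], [y] in [K].  This set is
invariant under negation, and it does not change when a convex [K] is replaced
by [half_difference K], because
[(a - b) / 2 - (c - d) / 2 = (a + d) / 2 - (b + c) / 2]
([differences_half_difference]).  Write [B] for [C `&` opp_set C].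

The gauge of [B] at [z] is the maximum of the gauge of [C] at [z] and at [- z]
([gauge_symm]).  Since [differences K `&` lin s] contains [- z] along with [z],
the largest gauge over it is the same for [B] as for [C]
([lengths_MIN_max_symm]), and the lengths over the half-line [pos s] are exactly
the [B]-lengths over the line [lin s] ([lengths_posE]).  For a symmetric body
the smallest homothet that covers a segment is centred at the midpoint, hence
twice the circumradius of the segment is the gauge of the difference of its
endpoints ([circumradius_segment]); this settles the arithmetic-mean lengths.

All maxima exist by the extreme value theorem: the gauge is continuous
([gauge_continuous]), and both [differences K] and its intersection with a line
are compact.  The diameter is attained in the direction of a longest difference
([has_max_maxlengths_MIN]), and the equalities between diameters follow from
those between lengths, direction by direction. *)

(** * Maxima, minima and convex combinations *)

Lemma max_ofE (R : realType) (A : set R) (m : R) :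
  A m -> ubound A m -> max_of A = m.
Proof.
move=> Am ubm; apply: xget_unique => // y [Ay uby].
by apply/eqP; rewrite eq_le ubm// uby.
Qed.

Lemma max_ofP (R : realType) (A : set R) :
  has_max A -> A (max_of A) /\ ubound A (max_of A).
Proof. by move=> [m [Am ubm]]; rewrite (max_ofE Am ubm). Qed.

Lemma min_ofE (R : realType) (A : set R) (m : R) :
  A m -> lbound A m -> min_of A = m.
Proof.
move=> Am lbm; apply: xget_unique => // y [Ay lby].
by apply/eqP; rewrite eq_le lby// lbm.
Qed.

Lemma inf_min (R : realType) (A : set R) (m : R) :
  A m -> lbound A m -> inf A = m.
Proof.
move=> Am lbm; apply/eqP; rewrite eq_le lb_le_inf//; last by exists m.
by rewrite andbT; apply: ge_inf => //; exists m.
Qed.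

Lemma convex_setP (R : realType) (n : nat) (K : set 'rV[R]_n) :
  convex_set (K : set (convex_lmodType 'rV[R]_n)) <->
  forall x y (a : R), 0 <= a <= 1 -> K x -> K y ->
    K (a *: x + (1 - a) *: y).
Proof.
split=> [cK x y a /andP[a0 a1] Kx Ky | cK x y a].
  by have /set_mem := cK x y (Itv01 a0 a1) (mem_set Kx) (mem_set Ky).
by move=> /set_mem Kx /set_mem Ky; apply/mem_set/cK => //; apply/andP; split.
Qed.

(** A conic combination is [a + b] times a convex one; when [a + b = 0] both
coefficients vanish and any point will do. *)
Lemma convex_set_cone (R : realType) (n : nat) (K : set 'rV[R]_n) x y (a b : R) :
  convex_set (K : set (convex_lmodType 'rV[R]_n)) ->
  0 <= a -> 0 <= b -> K x -> K y ->
  exists2 z, K z & (a + b) *: z = a *: x + b *: y.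
Proof.
move=> /convex_setP cK a0 b0 Kx Ky.
have [ab0|ab_neq0] := eqVneq (a + b) 0.
  exists x => //; have -> : a = 0 by lra.
  by have -> : b = 0; [lra | rewrite addr0 !scale0r addr0].
have ab_gt0 : 0 < a + b by rewrite lt_def ab_neq0 addr_ge0.
exists ((a / (a + b)) *: x + (1 - a / (a + b)) *: y).
  by apply: cK => //; rewrite divr_ge0 ?(ltW ab_gt0)//= ler_pdivrMr// mul1r lerDl.
rewrite scalerDr !scalerA mulrBr mulr1 mulrCA divff// mulr1.
by rewrite addrAC subrr add0r.
Qed.

(** * The gauge function *)

Definition gauge_body (R : realType) (n : nat) (C : set 'rV[R]_n) : Prop :=
  convex_body C /\ interior C 0.

Lemma dilateW (R : realType) (n : nat) (C : set 'rV[R]_n) (a b : R) x :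
  gauge_body C -> 0 <= a -> a <= b -> dilate a C x -> dilate b C x.
Proof.
move=> [[_ _ cC] /nbhs_singleton C0] a0 ab [c Cc <-].
have [||z Cz] := convex_set_cone (K := C) (a := a) (b := b - a) cC _ _ Cc C0.
- by [].
- by rewrite subr_ge0.
by rewrite subrKC scaler0 addr0 => <-; exists z.
Qed.

(** A neighbourhood of the origin absorbs every vector, at a rate linear in its
norm: this makes the gauge finite and Lipschitz. *)
Lemma dilate_absorb (R : realType) (n : nat) (C : set 'rV[R]_n) :
  gauge_body C -> exists2 k : R, 0 < k & forall x, dilate (k * `|x|) C x.
Proof.
move=> [_ nC]; have /nbhs_ballP[/= r r0 rC] := nC.
exists (2 / r) => [|x]; first by rewrite divr_gt0.
have [->|x0] := eqVneq x 0.
  by exists 0; [exact: (nbhs_singleton nC) | rewrite scaler0].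
have nx0 : 0 < `|x| by rewrite normr_gt0.
have k0 : 0 < 2 / r * `|x| by rewrite mulr_gt0// divr_gt0.
exists ((2 / r * `|x|)^-1 *: x); last by rewrite scalerA divff ?scale1r ?gt_eqF.
apply: rC; rewrite -ball_normE /= sub0r normrN normrZ gtr0_norm ?invr_gt0//.
rewrite invfM -mulrA mulVf ?gt_eqF// mulr1 invf_div.
by rewrite ltr_pdivrMr// ltr_pMr// ltr1n.
Qed.

(** The minimum that defines the gauge exists: the pairs [(l, c)] with
[0 <= l <= M], [c] in [C] and [l *: c = x] form a compact set, on which the first
coordinate has a minimum.  As the dilates of [C] increase with the factor, the
sublevel sets of the gauge are then exactly these dilates. *)
Lemma gauge_funP (R : realType) (n : nat) (C : set 'rV[R]_n) x :
  gauge_body C -> 0 <= gauge_fun C x /\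
  forall l : R, 0 <= l -> gauge_fun C x <= l <-> dilate l C x.
Proof.
move=> gC; have [[_ compC _] _] := gC.
pose S := [set l : R | 0 <= l /\ dilate l C x].
suff [m [m0 mx] mmin] : exists2 m, S m & lbound S m.
  have gE : gauge_fun C x = m by exact: min_ofE.
  rewrite gE; split=> // l l0; split=> [ml|lx]; last exact: mmin.
  exact: dilateW mx.
have [k k0 kx] := dilate_absorb gC.
set M : R := k * `|x|; have M0 : 0 <= M by rewrite mulr_ge0// ltW.
pose P : set (R * 'rV[R]_n) :=
  (`[0, M]%classic `*` C) `&` [set p | p.1 *: p.2 = x].
have [c Cc cx] : dilate M C x by exact: kx.
have P0 : P !=set0.
  by exists (M, c); split => //; split => //=; rewrite in_itv/= M0 lexx.
have cP : compact P.
  apply: compact_closedI; first by apply: compact_setX => //; exact: segment_compact.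
  apply: (@preimage_closed _ _ (fun p : R^o * 'rV[R]_n => p.1 *: p.2) [set x]).
    by move=> p _; exact: scale_continuous.
  exact/accessible_closed_set1/hausdorff_accessible/norm_hausdorff.
have [p /set_mem [[p1 Cp2] px] pmin] : exists2 p, p \in P & forall q, q \in P -> p.1 <= q.1.
  apply: compact_EVT_min => //; apply: continuous_subspaceT => q.
  exact: cvg_fst.
have p10 : 0 <= p.1 by move: p1; rewrite /= in_itv/= => /andP[].
exists p.1; first by split => //; exists p.2.
move=> l [l0 [d Cd dx]]; have [lM|/ltW Ml] := leP l M.
  by apply: (pmin (l, d)); apply/mem_set; split => //; split => //=; rewrite in_itv/= l0.
by apply: le_trans Ml; move: p1; rewrite /= in_itv/= => /andP[].
Qed.

Lemma gauge_ge0 (R : realType) (n : nat) (C : set 'rV[R]_n) x :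
  gauge_body C -> 0 <= gauge_fun C x.
Proof. by move=> /(gauge_funP x)[]. Qed.

Lemma gauge_le (R : realType) (n : nat) (C : set 'rV[R]_n) x (l : R) :
  gauge_body C -> 0 <= l -> gauge_fun C x <= l <-> dilate l C x.
Proof. by move=> /(gauge_funP x)[_]; apply. Qed.

Lemma gauge_mem (R : realType) (n : nat) (C : set 'rV[R]_n) x :
  gauge_body C -> dilate (gauge_fun C x) C x.
Proof. by move=> gC; apply/gauge_le => //; exact: gauge_ge0. Qed.

Lemma gaugeD (R : realType) (n : nat) (C : set 'rV[R]_n) x y :
  gauge_body C -> gauge_fun C (x + y) <= gauge_fun C x + gauge_fun C y.
Proof.
move=> gC; have gx := gauge_ge0 x gC; have gy := gauge_ge0 y gC.
apply/gauge_le => //; first exact: addr_ge0.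
have [c Cc cx] := gauge_mem x gC; have [d Cd dy] := gauge_mem y gC.
have [[_ _ cC] _] := gC.
by have [z Cz zE] := convex_set_cone cC gx gy Cc Cd; exists z; rewrite // zE cx dy.
Qed.

(** Subadditivity turns the linear bound on the gauge into a Lipschitz estimate. *)
Lemma gauge_continuous (R : realType) (n : nat) (C : set 'rV[R]_n) :
  gauge_body C -> continuous (gauge_fun C).
Proof.
move=> gC; have [k k0 kC] := dilate_absorb gC.
have lip x y : gauge_fun C x - gauge_fun C y <= k * `|x - y|.
  rewrite lerBlDl -{1}(subrKC y x); apply: le_trans (gaugeD _ _ gC) _.
  by rewrite lerD2l; apply/gauge_le => //; rewrite mulr_ge0// ltW.
move=> x; apply/(@cvgrPdist_lt _ _ _ _ (nbhs_filter x)) => e e0.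
have : nbhs x (ball x (e / k)) by apply: nbhsx_ballx; rewrite divr_gt0.
apply: filterS => y; rewrite -ball_normE /= ltr_pdivlMr// mulrC.
by apply: le_lt_trans; rewrite ler_norml lerNl opprB lip distrC lip.
Qed.

Lemma opp_setE (R : realType) (n : nat) (C : set 'rV[R]_n) x :
  opp_set C x <-> C (- x).
Proof. by split=> [[c Cc <-]|Cx]; [rewrite opprK | exists (- x); rewrite ?opprK]. Qed.

Lemma gauge_body_symm (R : realType) (n : nat) (C : set 'rV[R]_n) :
  gauge_body C -> gauge_body (C `&` opp_set C).
Proof.
move=> [[_ compC cC] nC].
have oppE : opp_set C = -%R @^-1` C by apply/seteqP; split => x /opp_setE.
have copp : continuous (-%R : 'rV[R]_n -> 'rV[R]_n) by exact: oppr_continuous.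
have nI : interior (C `&` opp_set C) 0.
  apply: filterI => //; rewrite oppE.
  by apply: copp; rewrite /= oppr0.
split=> //; split; first by exists 0; exact: nbhs_singleton.
  apply: compact_closedI => //; rewrite oppE; apply: preimage_closed.
    by move=> x _; exact: copp.
  exact: compact_closed (@norm_hausdorff _ _) compC.
apply/convex_setP => x y a a01 [Cx /opp_setE Cx'] [Cy /opp_setE Cy'].
move/convex_setP: cC => cC; split; first exact: cC.
by apply/opp_setE; rewrite opprD -!scalerN; exact: cC.
Qed.

Lemma dilate_opp_set (R : realType) (n : nat) (C : set 'rV[R]_n) (l : R) x :
  dilate l (opp_set C) x <-> dilate l C (- x).
Proof.
split=> [[_ [c Cc <-] <-]|[c Cc cx]].
  by exists c; rewrite // scalerN opprK.
by exists (- c); [exists c | rewrite scalerN cx opprK].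
Qed.

Lemma gauge_opp_set (R : realType) (n : nat) (C : set 'rV[R]_n) x :
  gauge_fun (opp_set C) x = gauge_fun C (- x).
Proof.
by congr min_of; apply/seteqP; split => l /= [l0 /dilate_opp_set].
Qed.

(** Intersecting bodies takes the maximum of their gauges, because
[l *: (C `&` D)] is the intersection of [l *: C] and [l *: D]. *)
Lemma gauge_symm (R : realType) (n : nat) (C : set 'rV[R]_n) x :
  gauge_body C ->
  gauge_fun (C `&` opp_set C) x = Num.max (gauge_fun C x) (gauge_fun C (- x)).
Proof.
move=> gC; have gB := gauge_body_symm gC.
have C0 : C 0 by case: gC => _ /nbhs_singleton.
have B0 : (C `&` opp_set C) 0 by split; rewrite // opp_setE oppr0.
apply/eqP; rewrite eq_le ge_max; apply/andP; split.
  have max0 : 0 <= Num.max (gauge_fun C x) (gauge_fun C (- x)).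
    by rewrite le_max gauge_ge0.
  apply/gauge_le => //.
  have [c Cc cx] : dilate (Num.max (gauge_fun C x) (gauge_fun C (- x))) C x.
    by apply/gauge_le; rewrite // le_max lexx.
  have [d Cd dx] : dilate (Num.max (gauge_fun C x) (gauge_fun C (- x))) C (- x).
    by apply/gauge_le; rewrite // le_max lexx orbT.
  (* the zero dilate is a single point and does not determine [c] *)
  have [m0|m_neq0] := eqVneq (Num.max (gauge_fun C x) (gauge_fun C (- x))) 0.
    by exists 0; rewrite // scaler0 -cx m0 scale0r.
  exists c => //; split=> //; apply/opp_setE.
  suff -> : - c = d by [].
  by apply: (scalerI m_neq0); rewrite dx scalerN cx.
have [c [Cc /opp_setE Cc'] cx] := gauge_mem x gB.
apply/andP; split; apply/gauge_le; rewrite ?gauge_ge0//; first by exists c.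
by exists (- c); rewrite // scalerN cx.
Qed.

Lemma gauge_symmN (R : realType) (n : nat) (C : set 'rV[R]_n) x :
  gauge_body C ->
  gauge_fun (C `&` opp_set C) (- x) = gauge_fun (C `&` opp_set C) x.
Proof. by move=> gC; rewrite !gauge_symm// opprK maxC. Qed.

(** If a translate of [rho *: C] contains [x] and [y], then [x - y] is [rho] times
a difference of two points of [C], which by symmetry lies in [2 *: C]: so [rho]
is at least half the gauge of [x - y].  Conversely that radius suffices around
the midpoint, from which a point of the segment differs by at most half of
[x - y], up to sign. *)
Lemma circumradius_segment (R : realType) (n : nat) (C : set 'rV[R]_n) x y :
  gauge_body C -> (forall z, C z -> C (- z)) ->
  2 * circumradius (segment x y) C = gauge_fun C (x - y).
Proof.
move=> gC symC; have [[_ _ cC] _] := gC.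
have [c Cc cxy] := gauge_mem (x - y) gC.
have g0 := gauge_ge0 (x - y) gC.
set g := gauge_fun C (x - y) in g0 cxy *.
suff -> : circumradius (segment x y) C = g / 2 by field.
apply: inf_min => /=.
  split; first by rewrite divr_ge0.
  (* cover the segment from its midpoint *)
  exists (2^-1 *: (x + y)) => _ [t /= /andP[t0 t1] <-].
  exists ((g / 2) *: ((1 - 2 * t) *: c)).
    exists ((1 - 2 * t) *: c) => //.
    have -> : (1 - 2 * t) *: c = (1 - t) *: c + (1 - (1 - t)) *: - c.
      by rewrite scalerN -scalerBl; congr (_ *: _); ring.
    move/convex_setP: cC; apply => //; [lra | exact: symC].
  have -> : (g / 2) *: ((1 - 2 * t) *: c) = ((1 - 2 * t) / 2) *: (x - y).
    by rewrite -cxy !scalerA; congr (_ *: _); ring.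
  by apply/rowP => i; rewrite !mxE; field.
move=> rho [rho0 [t ht]]; rewrite ler_pdivrMr//.
apply/gauge_le => //; first by rewrite mulr_ge0.
have [_ [a Ca <-] ax] : translate t (dilate rho C) x.
  by apply: ht; exists 0; rewrite /= ?lexx ?ler01// subr0 scale1r scale0r addr0.
have [_ [b Cb <-] bY] : translate t (dilate rho C) y.
  by apply: ht; exists 1; rewrite /= ?lexx ?ler01// subrr scale1r scale0r add0r.
exists (2^-1 *: a + (1 - 2^-1) *: - b).
  by move/convex_setP: cC; apply => //; [lra | exact: symC].
by rewrite -ax -bY; apply/rowP => i; rewrite !mxE; field.
Qed.

(** * Differences of points of a convex body *)

Definition differences (R : realType) (n : nat) (K : set 'rV[R]_n) : set 'rV[R]_n :=
  [set x - y | x in K & y in K].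

Lemma differencesN (R : realType) (n : nat) (K : set 'rV[R]_n) z :
  differences K z -> differences K (- z).
Proof. by move=> [x Kx [y Ky <-]]; rewrite opprB; exists y => //; exists x. Qed.

Lemma differences0 (R : realType) (n : nat) (K : set 'rV[R]_n) :
  K !=set0 -> differences K 0.
Proof. by move=> [x Kx]; exists x => //; exists x; rewrite ?subrr. Qed.

Lemma compact_differences (R : realType) (n : nat) (K : set 'rV[R]_n) :
  compact K -> compact (differences K).
Proof.
move=> cK.
have -> : differences K = (fun p => p.1 - p.2) @` (K `*` K).
  apply/seteqP; split => [_ [x Kx [y Ky <-]]|_ [[x y] [/= Kx Ky] <-]].
    by exists (x, y).
  by exists x => //; exists y.
apply: continuous_compact; last exact: compact_setX.
by apply: continuous_subspaceT => p; exact: sub_continuous.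
Qed.

Lemma differences_half_difference (R : realType) (n : nat) (K : set 'rV[R]_n) :
  convex_set (K : set (convex_lmodType 'rV[R]_n)) ->
  differences (half_difference K) = differences K.
Proof.
move=> /convex_setP cK; have half01 : 0 <= (2^-1 : R) <= 1 by lra.
apply/seteqP; split.
  move=> _ [_ [a Ka [b Kb <-]]] [_ [c Kc [d Kd <-]] <-].
  exists (2^-1 *: a + (1 - 2^-1) *: d); first exact: cK.
  exists (2^-1 *: b + (1 - 2^-1) *: c); first exact: cK.
  by apply/rowP => i; rewrite !mxE; field.
move=> _ [x Kx [y Ky <-]].
exists (2^-1 *: (x - y)); first by exists x => //; exists y.
exists (2^-1 *: (y - x)); first by exists y => //; exists x.
by apply/rowP => i; rewrite !mxE; field.
Qed.

Lemma lin0 (R : realType) (n : nat) (s : 'rV[R]_n) : lin s 0.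
Proof. by exists 0; rewrite // scale0r. Qed.

Lemma linN (R : realType) (n : nat) (s x : 'rV[R]_n) : lin s x -> lin s (- x).
Proof. by move=> [l _ <-]; exists (- l); rewrite // scaleNr. Qed.

Lemma lin_closed (R : realType) (n : nat) (s : 'rV[R]_n) :
  s != 0 -> closed (lin s).
Proof.
move=> /rV0Pn[i si].
(* [f] subtracts the multiple of [s] with the same [i]-th coordinate as [x], so
   that the line is its zero set *)
pose f (x : 'rV[R]_n) := x - (x 0 i / s 0 i) *: s.
have -> : lin s = f @^-1` [set 0].
  apply/seteqP; split => [_ [l _ <-]|x /eqP].
    by rewrite /preimage/= /f mxE mulfK// subrr.
  by rewrite subr_eq0 => /eqP ->; exists (x 0 i / s 0 i).
apply: preimage_closed.
  move=> x _; apply: (@cvgB R 'rV[R]_n _ (nbhs x) _ id); first exact: cvg_id.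
  apply: (@cvgZr_tmp R 'rV[R]_n _ (nbhs x) _).
  by apply: (@cvgMr_tmp R _ (nbhs x) _); exact: coord_continuous.
exact/accessible_closed_set1/hausdorff_accessible/norm_hausdorff.
Qed.

(** * Comparison of the length functionals *)

Lemma lengths_MINE (R : realType) (n : nat) (s : 'rV[R]_n) (K C : set 'rV[R]_n) :
  lengths_MIN s K C = gauge_fun C @` (differences K `&` lin s).
Proof.
apply/seteqP; split => [_ [[x y] [/= Kx Ky sxy] <-]|].
  by exists (x - y) => //; split => //; exists x => //; exists y.
by move=> _ [_ [[x Kx [y Ky <-]] sxy] <-]; exists (x, y).
Qed.

Lemma lengths_MIN_half (R : realType) (n : nat) (s : 'rV[R]_n)
    (K C : set 'rV[R]_n) :
  convex_set (K : set (convex_lmodType 'rV[R]_n)) ->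
  lengths_MIN s (half_difference K) C = lengths_MIN s K C.
Proof. by move=> cK; rewrite !lengths_MINE differences_half_difference. Qed.

Lemma lengths_AM_symm (R : realType) (n : nat) (s : 'rV[R]_n)
    (K C : set 'rV[R]_n) :
  gauge_body C -> (forall z, C z -> C (- z)) ->
  lengths_AM s K C = lengths_MIN s K C.
Proof.
by move=> gC symC; apply: eq_imagel => -[x y] _ /=; exact: circumradius_segment.
Qed.

(** Of [x - y] and [y - x], one lies on the half-line, and the gauge of the
symmetrized body does not distinguish them. *)
Lemma lengths_posE (R : realType) (n : nat) (s : 'rV[R]_n)
    (K C : set 'rV[R]_n) :
  gauge_body C -> lengths_pos s K C = lengths_MIN s K (C `&` opp_set C).
Proof.
move=> gC; apply/seteqP; split => [_ [[x y] [/= Kx Ky [l l0 lE]] <-]|].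
  by exists (x, y); [split => //; exists l | rewrite /= gauge_symm// gauge_opp_set].
move=> _ [[x y] [/= Kx Ky [l _ lE]] <-].
have [l0|/ltW l0] := leP 0 l.
  exists (x, y); first by split => //; exists l.
  by rewrite /= gauge_symm// gauge_opp_set.
exists (y, x); last by rewrite /= gauge_opp_set -gauge_symm// -[in RHS]opprB gauge_symmN.
by split => //=; exists (- l); rewrite /= ?oppr_ge0// scaleNr lE opprB.
Qed.

(** The gauge of [C `&` opp_set C] dominates that of [C], and at a maximizer [z]
it equals the gauge of [C] at [z] or at [- z], both of which are admissible. *)
Lemma lengths_MIN_max_symm (R : realType) (n : nat) (s : 'rV[R]_n)
    (K C : set 'rV[R]_n) (m : R) :
  gauge_body C ->
  lengths_MIN s K (C `&` opp_set C) m ->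
  ubound (lengths_MIN s K (C `&` opp_set C)) m ->
  lengths_MIN s K C m /\ ubound (lengths_MIN s K C) m.
Proof.
move=> gC; rewrite !lengths_MINE => -[z [Kz sz] <-] ubm; split.
  rewrite gauge_symm//; case: leP => _; last by exists z.
  by exists (- z) => //; split; [exact: differencesN | exact: linN].
move=> _ [w [Kw sw] <-].
have /ubm : (gauge_fun (C `&` opp_set C) @` (differences K `&` lin s))
  (gauge_fun (C `&` opp_set C) w) by exists w.
by apply: le_trans; rewrite [leRHS]gauge_symm// le_max lexx.
Qed.

Lemma gauge_max (R : realType) (n : nat) (C A : set 'rV[R]_n) :
  gauge_body C -> A !=set0 -> compact A ->
  exists2 z, A z & forall w, A w -> gauge_fun C w <= gauge_fun C z.
Proof.
move=> gC A0 cA.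
have [|z /set_mem Az zmax] := @EVT_max_rV _ _ (gauge_fun C) A A0 cA.
  by apply: continuous_subspaceT; exact: gauge_continuous.
by exists z => // w Aw; apply/zmax/mem_set.
Qed.

Lemma has_max_lengths_MIN (R : realType) (n : nat) (s : 'rV[R]_n)
    (K C : set 'rV[R]_n) :
  convex_body K -> gauge_body C -> s != 0 -> has_max (lengths_MIN s K C).
Proof.
move=> [K0 cK _] gC s0; rewrite lengths_MINE.
have [||z Az zmax] := gauge_max (A := differences K `&` lin s) gC.
- by exists 0; split; [exact: differences0 | exact: lin0].
- by apply: compact_closedI; [exact: compact_differences | exact: lin_closed].
by exists (gauge_fun C z); split; [exists z | move=> _ [w Aw <-]; exact: zmax].
Qed.

(** The direction of a longest difference [z] realizes the diameter.  If [z = 0]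
then all lengths vanish and any direction serves; [s] supplies one. *)
Lemma has_max_maxlengths_MIN (R : realType) (n : nat) (s : 'rV[R]_n)
    (K C : set 'rV[R]_n) :
  convex_body K -> gauge_body C -> s != 0 -> has_max (maxlengths_MIN K C).
Proof.
move=> hK gC s0; have [K0 cK _] := hK.
have [z Kz zmax] : exists2 z, differences K z &
    forall w, differences K w -> gauge_fun C w <= gauge_fun C z.
  apply: gauge_max => //; last exact: compact_differences.
  by exists 0; exact: differences0.
have lP r : r != 0 -> lengths_MIN r K C (l_MIN r K C) /\
    ubound (lengths_MIN r K C) (l_MIN r K C).
  by move=> r0; apply/max_ofP/has_max_lengths_MIN.
have ub r : r != 0 -> l_MIN r K C <= gauge_fun C z.
  by move=> /lP[]; rewrite lengths_MINE => -[w [Kw _] <-] _; exact: zmax.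
suff [r r0 zr] : exists2 r : 'rV[R]_n, r != 0 & lin r z.
  have rE : l_MIN r K C = gauge_fun C z.
    apply/eqP; rewrite eq_le ub//=; apply: (lP r r0).2.
    by rewrite lengths_MINE; exists z.
  by exists (gauge_fun C z); split; [exists r | move=> _ [t t0 <-]; exact: ub].
have [->|z0] := eqVneq z 0; first by exists s; rewrite //; exact: lin0.
by exists z => //; exists 1; rewrite // scale1r.
Qed.

Theorem lemma2p4 (R : realType) (n : nat) (hn : (2 <= n)%N)
    (K C : set 'rV[R]_n) (s : 'rV[R]_n)
    (hK : convex_body K) (hC : convex_body C)
    (hC0 : interior C 0) (hCM : Minkowski_centered C) (hs : s != 0) :
  (* (i) *)
  (( [/\ has_max (lengths_MIN s K C),
         has_max (lengths_pos s K C) &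
         has_max (lengths_MIN s K (C `&` opp_set C))] /\
     [/\ has_max (lengths_AM s K (C `&` opp_set C)),
         has_max (lengths_MIN s (half_difference K) (C `&` opp_set C)) &
         has_max (lengths_MIN s (half_difference K) C)]) /\
   [/\ l_MIN s K C = max_of (lengths_pos s K C),
       max_of (lengths_pos s K C) = l_MIN s K (C `&` opp_set C),
       l_MIN s K (C `&` opp_set C) = l_AM s K (C `&` opp_set C),
       l_AM s K (C `&` opp_set C)
         = l_MIN s (half_difference K) (C `&` opp_set C) &
       l_MIN s (half_difference K) (C `&` opp_set C)
         = l_MIN s (half_difference K) C])
  /\
  (* (ii) *)
  ([/\ has_max (maxlengths_MIN K C),
       has_max (maxlengths_MIN K (C `&` opp_set C)),
       has_max (maxlengths_MIN (half_difference K) (C `&` opp_set C)),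
       has_max (maxlengths_MIN (half_difference K) C) &
       has_max (maxlengths_AM K (C `&` opp_set C))] /\
   [/\ D_MIN K C = D_MIN K (C `&` opp_set C),
       D_MIN K (C `&` opp_set C)
         = D_MIN (half_difference K) (C `&` opp_set C),
       D_MIN (half_difference K) (C `&` opp_set C)
         = D_MIN (half_difference K) C &
       D_MIN (half_difference K) C = D_AM K (C `&` opp_set C)]).
Proof.
have gC : gauge_body C by [].
have gB := gauge_body_symm gC.
set B := C `&` opp_set C in gB *.
have symB z : B z -> B (- z).
  by move=> [Cz /opp_setE Cz']; split=> //; apply/opp_setE; rewrite opprK.
have cK : convex_set (K : set (convex_lmodType 'rV[R]_n)) by case: hK.
have maxB r : r != 0 -> has_max (lengths_MIN r K B) by exact: has_max_lengths_MIN.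
have maxC r : r != 0 -> has_max (lengths_MIN r K C) /\ l_MIN r K C = l_MIN r K B.
  move=> r0; have [m [Am ubm]] := maxB r r0.
  have [Cm ubCm] := lengths_MIN_max_symm gC Am ubm.
  by split; [exists m | rewrite /l_MIN (max_ofE Cm ubCm) (max_ofE Am ubm)].
have AM r : lengths_AM r K B = lengths_MIN r K B by exact: lengths_AM_symm.
have half r A : lengths_MIN r (half_difference K) A = lengths_MIN r K A.
  exact: lengths_MIN_half.
have [hasC lC] := maxC s hs.
split.
  rewrite /l_MIN /l_AM !half !AM lengths_posE// -/B.
  by split; [split; split => //; exact: maxB | split].
have halfD A : maxlengths_MIN (half_difference K) A = maxlengths_MIN K A.
  by apply: eq_imagel => r _; rewrite /l_MIN half.
have AMD : maxlengths_AM K B = maxlengths_MIN K B.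
  by apply: eq_imagel => r _; rewrite /l_AM AM.
have CD : maxlengths_MIN K C = maxlengths_MIN K B.
  by apply: eq_imagel => r r0; rewrite (maxC r r0).2.
have maxD := has_max_maxlengths_MIN hK gB hs.
by rewrite /D_MIN /D_AM !halfD AMD CD.
Qed.
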